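(* Let $X$ be a finite set with $|X|>2$, let $G\le\operatorname{Sym}(X)$ be a (transitive) quasiprimitive permutation group on $X$, let $e\in X$ with stabilizer $G_e$, and let $\rho,\rho'\in Z(G_e)$ satisfy $\langle\rho^G\rangle=G$ and $\langle\rho'^G\rangle=G$. Suppose that the quasiprimitive quandles $\mathcal{QPQ}(G,\rho)$ and $\mathcal{QPQ}(G,\rho')$ are faithful. Then $\mathcal{QPQ}(G,\rho)\cong\mathcal{QPQ}(G,\rho')$ as quandles if and only if there exists an automorphism $\phi$ of the group $G$ satisfying $\phi(\rho^G)=\rho'^G$.
   Context: A quandle is a set $X$ with a binary operation $\triangleright$ such that (1) $x\triangleright x=x$ for all $x$; (2) for every $x\in X$ the right translation $R_x:X\to X$, $R_x(y)=y\triangleright x$, is a bijection; (3) $(x\triangleright y)\triangleright z=(x\triangleright z)\triangleright(y\triangleright z)$ for all $x,y,z$. $\operatorname{Inn}(X)=\langle R_x:x\in X\rangle\le\operatorname{Sym}(X)$. A quandle is faithful if the map $x\mapsto R_x$ is injective. An action of a group on a set is quasiprimitive if it is faithful and its restriction to every nontrivial normal subgroup is transitive; a quandle $X$ is quasiprimitive if the action of $\operatorname{Inn}(X)$ on $X$ is quasiprimitive. For $\rho\in G$, $\rho^G$ denotes the conjugacy class of $\rho$ in $G$, and $Z(\cdot)$ the center. For $G$ a quasiprimitive group on a finite set $X$, $|X|>2$, $e\in X$, $\rho\in Z(G_e)$ with $\langle\rho^G\rangle=G$, the quandle $\mathcal{QPQ}(G,\rho)=(X,\circ)$ is defined by $x\circ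 y=\alpha_y\rho\alpha_y^{-1}(x)$, where $\alpha_y\in G$ is any element with $\alpha_y(e)=y$ (the result does not depend on the choice). It satisfies $\operatorname{Inn}(X,\circ)=G$. *)

(* Defs.v *)
From mathcomp Require Import all_boot all_fingroup all_solvable.

Set Implicit Arguments.
Unset Strict Implicit.
Unset Printing Implicit Defensive.

Local Open Scope group_scope.

Record is_quandle (T : Type) (op : T -> T -> T) : Prop := IsQuandle {
  quandle_idem : forall x, op x x = x;
  quandle_bij : forall x, bijective (fun y => op y x);
  quandle_distr : forall x y z, op (op x y) z = op (op x z) (op y z)
}.

(* Injectivity of x |-> R_x, with right translations compared pointwise. *)
Definition quandle_faithful (T : Type) (op : T -> T -> T) : Prop :=
  forall y z, (fun x => op x y) =1 (fun x => op x z) -> y = z.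

Definition quandle_isomorphic (T U : Type)
    (opT : T -> T -> T) (opU : U -> U -> U) : Prop :=
  exists2 f : T -> U, bijective f & {morph f : x y / opT x y >-> opU x y}.

(* Transitivity of the acting group itself is not part of this definition: it
   follows when the group is nontrivial, but the trivial group satisfies the
   condition vacuously. *)
Definition quasiprimitive (aT : finGroupType) (rT : finType)
    (G : {group aT}) (S : {set rT}) (to : {action aT &-> rT}) : Prop :=
  [faithful G, on S | to] /\
  (forall N : {group aT}, N <| G -> N :!=: 1 -> [transitive N, on S | to]).

(* An element of G mapping e to y; it is 1 if there is none, which does not
   happen when G is transitive. *)
Definition transporter (X : finType) (G : {group {perm X}}) (e y : X) :
    {perm X} :=
  odflt 1 [pick a in G | a e == y].

(* Products in {perm X} compose from left to right, so the composition of
   functions is written out here; as an element of {perm X} the right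
   translation by y is rho ^ transporter G e y. *)
Definition qpq (X : finType) (G : {group {perm X}}) (e : X) (rho : {perm X})
    (x y : X) : X :=
  let a := transporter G e y in a (rho (a^-1 x)).

Section QPQ.

Variables (X : finType) (G : {group {perm X}}) (e : X) (rho : {perm X}).
Hypothesis trG : [transitive G, on [set: X] | 'P].
Hypothesis rhoZ : rho \in 'Z('C_G[e | 'P]).

Lemma transporterP y :
  transporter G e y \in G /\ transporter G e y e = y.
Proof.
rewrite /transporter; case: pickP => [a /andP[aG /eqP] // | no_a].
have [a aG y_ae] := atransP2 trG (in_setT e) (in_setT y).
by have := no_a a; rewrite aG y_ae eqxx.
Qed.

Lemma qpqE a x : a \in G -> qpq G e rho x (a e) = a (rho (a^-1 x)).
Proof.
move=> aG; rewrite /qpq; have [bG] := transporterP (a e).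
move: (transporter _ _ _) bG => b bG be.
have /centerP[_ rhoC] := rhoZ.
have cS : a * b^-1 \in 'C_G[e | 'P].
  rewrite !inE groupM ?groupV //= sub1set inE /= /aperm permM -be permK.
  by rewrite eqxx.
have /permP/(_ (a^-1 x)) := rhoC _ cS.
by rewrite !permM permKV => <-; rewrite permKV.
Qed.

Lemma qpq_quandle : is_quandle (qpq G e rho).
Proof.
have /centerP[rhoS _] := rhoZ.
have [rhoG rho_e] : rho \in G /\ rho e = e.
  move: rhoS => /setIP[-> /astab1P]; by [].
have tr y : exists2 a, a \in G & y = a e.
  by have [? ?] := transporterP y; exists (transporter G e y).
split=> [x | x | x y z].
- by have [a aG ->] := tr x; rewrite qpqE // permK rho_e.
- have [a aG ->] := tr x; exists (fun y => a (rho^-1 (a^-1 y))) => y /=;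
    by rewrite qpqE // !(permK, permKV).
have [[a aG ->] [b bG ->]] := (tr y, tr z).
rewrite !qpqE //.
have -> : b (rho (b^-1 (a e))) = (a * (b^-1 * rho * b)) e by rewrite !permM.
by rewrite qpqE ?groupM ?groupV // !invMg !permM invgK !permK permKV.
Qed.

End QPQ.

(* Main.v *)
Require Import Defs.
From mathcomp Require Import all_boot all_fingroup all_solvable.

Set Implicit Arguments.
Unset Strict Implicit.
Unset Printing Implicit Defensive.

Local Open Scope group_scope.

(** The theorem transports quandle structure through right translations. Write
    R y for the right translation by y in the quandle built from rho. Then
    R (a e) = rho ^ a for every a in G, so R is a G-equivariant map from X onto
    the class rho ^: G, and it is injective exactly when the quandle is
    faithful. Since x o y = R y x, equivariance gives R (x o y) = R x ^ R y:
    a faithful quandle is a copy, via R, of the conjugation quandle on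
    rho ^: G.

    An isomorphism f, seen as a permutation of X, conjugates R y to R' (f y)
    (qpq_trans_morphJ). Hence it conjugates rho ^: G onto rho' ^: G and so,
    both classes being generating sets, normalises G; conjugation by f is the
    required automorphism. Conversely, an automorphism of G carrying one class
    onto the other is an isomorphism of conjugation quandles, which is pulled
    back to X through the bijections R and R' (qpq_isomorphic_of_class_iso). *)

Definition qpq_trans (X : finType) (G : {group {perm X}}) (e : X)
    (rho : {perm X}) (y : X) : {perm X} :=
  rho ^ transporter G e y.

Lemma qpq_transE (X : finType) (G : {group {perm X}}) (e : X)
    (rho : {perm X}) (x y : X) :
  qpq_trans G e rho y x = qpq G e rho x y.
Proof. by rewrite /qpq_trans conjgE !permM. Qed.

(** The choice made by the transporter is immaterial because rho is central in
    the stabiliser of e. *)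
Lemma qpq_trans_base (X : finType) (G : {group {perm X}}) (e : X)
    (rho a : {perm X}) :
  [transitive G, on [set: X] | 'P] -> rho \in 'Z('C_G[e | 'P]) ->
  a \in G -> qpq_trans G e rho (a e) = rho ^ a.
Proof.
move=> trG rhoZ aG; apply/permP=> x.
by rewrite qpq_transE qpqE // conjgE !permM.
Qed.

Lemma qpq_transJ (X : finType) (G : {group {perm X}}) (e : X)
    (rho a : {perm X}) (y : X) :
  [transitive G, on [set: X] | 'P] -> rho \in 'Z('C_G[e | 'P]) ->
  a \in G -> qpq_trans G e rho (a y) = qpq_trans G e rho y ^ a.
Proof.
move=> trG rhoZ aG; have [bG be] := transporterP e trG y.
by rewrite -{1}be -permM qpq_trans_base ?groupM // conjgM.
Qed.

Lemma imset_qpq_trans (X : finType) (G : {group {perm X}}) (e : X)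
    (rho : {perm X}) :
  [transitive G, on [set: X] | 'P] -> rho \in 'Z('C_G[e | 'P]) ->
  [set qpq_trans G e rho y | y : X] = rho ^: G.
Proof.
move=> trG rhoZ; apply/setP=> s; apply/imsetP/imsetP=> [[y _ ->]|[a aG ->]].
  by exists (transporter G e y) => //; have [] := transporterP e trG y.
by exists (a e); rewrite ?qpq_trans_base.
Qed.

Lemma qpq_trans_class (X : finType) (G : {group {perm X}}) (e : X)
    (rho : {perm X}) (y : X) :
  [transitive G, on [set: X] | 'P] -> rho \in 'Z('C_G[e | 'P]) ->
  qpq_trans G e rho y \in rho ^: G.
Proof. by move=> trG rhoZ; rewrite -(imset_qpq_trans trG rhoZ) imset_f. Qed.

Lemma qpq_trans_in (X : finType) (G : {group {perm X}}) (e : X)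
    (rho : {perm X}) (y : X) :
  [transitive G, on [set: X] | 'P] -> rho \in 'Z('C_G[e | 'P]) ->
  qpq_trans G e rho y \in G.
Proof.
move=> trG rhoZ; have /centerP[/setIP[rhoG _] _] := rhoZ.
by rewrite groupJ //; have [] := transporterP e trG y.
Qed.

(** This is equivariance of the right translations, applied to a right
    translation itself: they map the quandle to the conjugation quandle
    of G. *)
Lemma qpq_trans_morph (X : finType) (G : {group {perm X}}) (e : X)
    (rho : {perm X}) :
  [transitive G, on [set: X] | 'P] -> rho \in 'Z('C_G[e | 'P]) ->
  {morph qpq_trans G e rho : x y / qpq G e rho x y >-> x ^ y}.
Proof.
move=> trG rhoZ x y.
by rewrite -qpq_transE qpq_transJ ?qpq_trans_in.
Qed.

Lemma qpq_trans_inj (X : finType) (G : {group {perm X}}) (e : X)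
    (rho : {perm X}) :
  quandle_faithful (qpq G e rho) -> injective (qpq_trans G e rho).
Proof. by move=> faith y z Ryz; apply: faith => x; rewrite -!qpq_transE Ryz. Qed.

(** Right translations are defined from the operation alone, so a bijective
    morphism carries them to right translations. *)
Lemma qpq_trans_morphJ (X : finType) (G : {group {perm X}}) (e : X)
    (rho rho' p : {perm X}) (y : X) :
  {morph p : x y / qpq G e rho x y >-> qpq G e rho' x y} ->
  qpq_trans G e rho y ^ p = qpq_trans G e rho' (p y).
Proof.
move=> pM; apply/permP=> x; rewrite -(permKV p x) permJ !qpq_transE.
exact: pM.
Qed.

Lemma class_conj_of_qpq_morph (X : finType) (G : {group {perm X}}) (e : X)
    (rho rho' p : {perm X}) :
  [transitive G, on [set: X] | 'P] ->
  rho \in 'Z('C_G[e | 'P]) -> rho' \in 'Z('C_G[e | 'P]) ->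
  {morph p : x y / qpq G e rho x y >-> qpq G e rho' x y} ->
  (rho ^: G) :^ p = rho' ^: G.
Proof.
move=> trG rhoZ rho'Z pM.
rewrite -(imset_qpq_trans trG rhoZ) -(imset_qpq_trans trG rho'Z).
apply/setP=> s; apply/imsetP/imsetP=> [[_ /imsetP[y _ ->] ->] | [y _ ->]].
  by exists (p y); rewrite // (qpq_trans_morphJ _ pM).
exists (qpq_trans G e rho (p^-1 y)); first exact: imset_f.
by rewrite (qpq_trans_morphJ _ pM) permKV.
Qed.

(** Send x to the point f x whose right translation is the image under phi of
    the right translation by x. Faithfulness of the
    target reduces the morphism law for f to that of phi on conjugates; faithfulness of the source makes f injective, hence
    bijective as X is finite. *)
Lemma qpq_isomorphic_of_class_iso (X : finType) (G : {group {perm X}}) (e : X)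
    (rho rho' : {perm X}) (phi : {perm {perm X}}) :
  [transitive G, on [set: X] | 'P] ->
  rho \in 'Z('C_G[e | 'P]) -> rho' \in 'Z('C_G[e | 'P]) ->
  quandle_faithful (qpq G e rho) -> quandle_faithful (qpq G e rho') ->
  phi \in Aut G -> [set phi s | s in rho ^: G] = rho' ^: G ->
  quandle_isomorphic (qpq G e rho) (qpq G e rho').
Proof.
move=> trG rhoZ rho'Z /qpq_trans_inj Rinj /qpq_trans_inj R'inj phiA phi_cl.
have lift x : {y | qpq_trans G e rho' y == phi (qpq_trans G e rho x)}.
  apply: sigW; have : phi (qpq_trans G e rho x) \in rho' ^: G.
    by rewrite -phi_cl imset_f ?qpq_trans_class.
  by rewrite -(imset_qpq_trans trG rho'Z) => /imsetP[y _ ->]; exists y.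
pose f x := sval (lift x).
have R'f x : qpq_trans G e rho' (f x) = phi (qpq_trans G e rho x).
  exact/eqP/(svalP (lift x)).
exists f.
  apply: injF_bij => x y fxy; apply: Rinj; apply: (@perm_inj _ phi).
  by rewrite -!R'f fxy.
have phiJ := morphJ (autm_morphism phiA).
move=> x y; apply: R'inj; rewrite R'f !qpq_trans_morph // !R'f.
by apply: phiJ; apply: qpq_trans_in.
Qed.

Theorem theorem3p5 (X : finType) (X_gt2 : 2 < #|X|)
    (G : {group {perm X}})
    (trG : [transitive G, on [set: X] | 'P])
    (qpG : quasiprimitive G [set: X] 'P)
    (e : X) (rho rho' : {perm X})
    (rhoZ : rho \in 'Z('C_G[e | 'P])) (rho'Z : rho' \in 'Z('C_G[e | 'P]))
    (gen_rho : <<rho ^: G>> = G) (gen_rho' : <<rho' ^: G>> = G)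
    (faith_rho : quandle_faithful (qpq G e rho))
    (faith_rho' : quandle_faithful (qpq G e rho')) :
  quandle_isomorphic (qpq G e rho) (qpq G e rho') <->
  (exists2 phi : {perm {perm X}},
     phi \in Aut G & [set phi s | s in rho ^: G] = rho' ^: G).
Proof.
split=> [[f fbij fM] | [phi phiA phi_cl]]; last first.
  exact: qpq_isomorphic_of_class_iso phi_cl.
pose p := perm (bij_inj fbij).
have pM : {morph p : x y / qpq G e rho x y >-> qpq G e rho' x y}.
  by move=> x y; rewrite !permE fM.
have clJ := class_conj_of_qpq_morph trG rhoZ rho'Z pM.
have nGp : p \in 'N(G).
  by apply/normP; rewrite -{1}gen_rho -genJ clJ.
have rhoG : rho \in G by have /centerP[/setIP[]] := rhoZ.
exists (conj_aut G p); first exact: Aut_aut.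
rewrite -clJ; apply: eq_in_imset => s /imsetP[a aG ->].
by rewrite norm_conj_autE ?groupJ.
Qed.
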